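(* Let $T$ be a complete first-order theory in a countable language, $\mathfrak{C}$ a monster model, $\alpha$ an infinite countable ordinal, and $Y\subseteq\mathfrak{C}^{\alpha}$ a pseudo $G_{\delta}$ set closed under $\equiv_{L}^{\alpha}$. Assume that for every tuple in $Y$ and every finite sub-tuple $c\in\mathfrak{C}^{k}$ of it, the class $[c]_{\equiv_{L}^{k}}$ is $d$-bounded. If for some $\bar{a}\in Y$ the class $[\bar{a}]_{\equiv_{L}^{\alpha}}$ is not $d$-bounded, then $\equiv_{L}^{\alpha}\restriction Y$ is non-smooth.
   Context: $\mathfrak{C}$ is a $\kappa$-saturated, $\kappa$-homogeneous model of $T$ for some $\kappa\geq(2^{|T|})^{+}$; ''small'' means cardinality $<\kappa$. A subset of $\mathfrak{C}^{\alpha}$ is pseudo closed if type-definable over a small set, pseudo open if its complement is pseudo closed, pseudo $G_{\delta}$ if a countable intersection of pseudo open sets. For an ordinal $\beta$, the Lascar graph on $\mathfrak{C}^{\beta}$ joins two distinct tuples lying on a common infinite indiscernible sequence (over $\emptyset$); $d_{\beta}$ is its graph distance and $\equiv_{L}^{\beta}$ has as classes its connected components. A set $Z$ closed under $\equiv_{L}^{\beta}$ is $d$-bounded if there is $n$ with $a\equiv_{L}^{\beta}b\iff d_{\beta}(a,b)\leq n$ for all $a,b\in Z$. For a countable model $M$, $S_{\alpha}(M)$ is the Polish Stone space of complete $\alpha$-types over $M$, $p\equiv_{L}^{\alpha,M}q$ iff there are $a\models p$, $b\models q$ with $a\equiv_{L}^{\alpha}b$, and $Y_{M}=\{\operatorname{tp}(a/M):a\in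 Y\}$ (a Polish subspace). Smooth means Borel reducible to equality on $2^{\omega}$; ''$\equiv_{L}^{\alpha}\restriction Y$ is non-smooth'' means $\equiv_{L}^{\alpha,M}\restriction Y_{M}$ is not smooth for a countable model $M$ (independent of $M$). *)

(* Defs.v *)
From mathcomp Require Import all_boot.
Set Implicit Arguments.
Unset Strict Implicit.
Unset Printing Implicit Defensive.

Record language := Language {
  Func : Type; Rel : Type; farity : Func -> nat; rarity : Rel -> nat }.

Definition injects (X Y : Type) := exists f : X -> Y, injective f.
Definition countable_type (X : Type) := injects X nat.
Definition countable_language (L : language) :=
  countable_type (Func L) /\ countable_type (Rel L).
Definition lt_card (X Y : Type) := injects X Y /\ ~ injects Y X.

Section FOL.
Variable L : language.

Inductive term (X : Type) : Type :=
  | tvar : X -> term X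
  | tapp : forall f : Func L, ('I_(farity f) -> term X) -> term X.

(* formulas with free variables in X; fEx binds the new variable None *)
Inductive formula (X : Type) : Type :=
  | fRel : forall r : Rel L, ('I_(rarity r) -> term X) -> formula X
  | fEq : term X -> term X -> formula X
  | fNeg : formula X -> formula X
  | fAnd : formula X -> formula X -> formula X
  | fEx : formula (option X) -> formula X.

Record structure := Structure {
  carrier :> Type;
  point : carrier; (* structures are nonempty *)
  sfun : forall f : Func L, ('I_(farity f) -> carrier) -> carrier;
  srel : forall r : Rel L, ('I_(rarity r) -> carrier) -> Prop }.
Arguments sfun {s} f _.
Arguments srel {s} r _.

Fixpoint eval (M : structure) (X : Type) (e : X -> M) (t : term X) : M :=
  match t with
  | tvar x => e x
  | tapp f ts => sfun f (fun i => eval e (ts i))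
  end.

Definition ext_env (M : structure) (X : Type) (e : X -> M) (m : M) :
  option X -> M := fun o => match o with Some x => e x | None => m end.

Fixpoint sat (M : structure) (X : Type) (e : X -> M) (phi : formula X)
  {struct phi} : Prop :=
  match phi with
  | fRel r ts => srel r (fun i => eval e (ts i))
  | fEq t1 t2 => eval e t1 = eval e t2
  | fNeg psi => ~ sat e psi
  | fAnd psi chi => sat e psi /\ sat e chi
  | fEx psi => exists m : M, sat (ext_env e m) psi
  end.

Definition sentence := formula Empty_set.
Definition empty_env (M : structure) : Empty_set -> M :=
  fun x => match x with end.
Definition models (M : structure) (T : sentence -> Prop) :=
  forall s, T s -> sat (empty_env M) s.
Definition entails (T : sentence -> Prop) (s : sentence) :=
  forall M : structure, models M T -> sat (empty_env M) s.
Definition complete_theory (T : sentence -> Prop) :=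
  (exists M : structure, models M T) /\
  forall s, entails T s \/ entails T (fNeg s).

Record pform (X : Type) (C : structure) (A : C -> Prop) := PForm {
  pn : nat;
  pphi : formula (X + 'I_pn);
  ppar : 'I_pn -> C;
  ppar_in : forall i, A (ppar i) }.
Arguments pn {X C A} p.
Arguments pphi {X C A} p.
Arguments ppar {X C A} p _.

Definition psat (X : Type) (C : structure) (A : C -> Prop) (a : X -> C)
  (phi : pform X A) : Prop :=
  sat (fun z => match z with inl x => a x | inr i => ppar phi i end) (pphi phi).

Section Monster.
Variables (K : Type) (C : structure).
(* kappa is represented by the type K; "small" = cardinality < kappa *)
Definition small (A : C -> Prop) := lt_card {x | A x} K.

Definition saturated :=
  forall A, small A -> forall p : pform unit A -> Prop,
    (forall n (ps : 'I_n -> pform unit A), (forall i, p (ps i)) ->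
       exists c : C, forall i, psat (fun _ => c) (ps i)) ->
    exists c : C, forall phi, p phi -> psat (fun _ => c) phi.

Definition automorphism (s : C -> C) :=
  bijective s /\
  (forall f args, s (sfun f args) = sfun f (s \o args)) /\
  (forall r args, srel r (s \o args) <-> srel r args).

Definition homogeneous :=
  forall A, small A -> forall g : C -> C,
    (forall n (phi : formula 'I_n) (a : 'I_n -> C), (forall i, A (a i)) ->
       (sat a phi <-> sat (g \o a) phi)) ->
    exists s, automorphism s /\ forall x, A x -> s x = g x.

(* kappa >= (2^|T|)^+ with |T| = aleph_0 (countable language) *)
Definition monster (T : sentence -> Prop) :=
  models C T /\ saturated /\ homogeneous /\ lt_card (nat -> bool) K.

Definition pseudo_closed (B : Type) (P : (B -> C) -> Prop) :=
  exists A, small A /\ exists S : pform B A -> Prop,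
    forall a, P a <-> forall phi, S phi -> psat a phi.
Definition pseudo_open (B : Type) (P : (B -> C) -> Prop) :=
  pseudo_closed (fun a => ~ P a).
Definition pseudo_Gdelta (B : Type) (Y : (B -> C) -> Prop) :=
  exists U : nat -> (B -> C) -> Prop,
    (forall n, pseudo_open (U n)) /\ forall a, Y a <-> forall n, U n a.
End Monster.

Section Lascar.
Variables (C : structure) (B : Type).

Definition increasing n (i : 'I_n -> nat) :=
  forall p q : 'I_n, (p < q)%N -> (i p < i q)%N.

Definition indiscernible (e : nat -> B -> C) :=
  forall n (phi : formula ('I_n * B)) (i j : 'I_n -> nat),
    increasing i -> increasing j ->
    (sat (fun p => e (i p.1) p.2) phi <-> sat (fun p => e (j p.1) p.2) phi).

Definition lascar_edge (a b : B -> C) :=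
  a <> b /\ exists e, indiscernible e /\ exists i j, e i = a /\ e j = b.

Fixpoint ldist_le (n : nat) (a b : B -> C) : Prop :=
  match n with
  | 0 => a = b
  | S n => exists c, ldist_le n a c /\ (c = b \/ lascar_edge c b)
  end.

Definition lascar_eq (a b : B -> C) := exists n, ldist_le n a b.
Definition lclass (a : B -> C) := fun b => lascar_eq a b.
Definition d_bounded (Z : (B -> C) -> Prop) :=
  exists n, forall a b, Z a -> Z b -> (lascar_eq a b <-> ldist_le n a b).
End Lascar.

Section Sub.
Variables (C : structure) (M : C -> Prop) (m0 : {x | M x})
  (Hcl : forall f (args : 'I_(farity f) -> C),
          (forall i, M (args i)) -> M (sfun f args)).

Definition induced : structure :=
  {| carrier := {x | M x};
     point := m0;
     sfun := fun f args => exist M (sfun f (sval \o args))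
                 (Hcl (fun i => proj2_sig (args i)));
     srel := fun r args => srel r (sval \o args) |}.
End Sub.

Definition elementary_sub (C : structure) (M : C -> Prop) :=
  exists (m0 : {x | M x}) (Hcl : forall f (args : 'I_(farity f) -> C),
          (forall i, M (args i)) -> M (sfun f args)),
    forall n (phi : formula 'I_n) (a : 'I_n -> {x | M x}),
      sat (M := induced m0 Hcl) a phi <-> sat (sval \o a) phi.

Definition countable_model (C : structure) (M : C -> Prop) :=
  countable_type {x | M x} /\ elementary_sub M.

Section Types.
Variables (C : structure) (M : C -> Prop) (B : Type).

Definition tp (a : B -> C) : pform B M -> Prop := fun phi => psat a phi.

Definition typeset (Y : (B -> C) -> Prop) : (pform B M -> Prop) -> Prop :=
  fun p => exists a, Y a /\ tp a = p.

Definition ltypeE (p q : pform B M -> Prop) :=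
  exists a b, tp a = p /\ tp b = q /\ lascar_eq a b.

Definition stone_open (Om : (pform B M -> Prop) -> Prop)
  (U : (pform B M -> Prop) -> Prop) :=
  (forall p, U p -> Om p) /\
  forall p, U p -> exists phi, p phi /\ forall q, Om q -> q phi -> U q.
End Types.

Definition sigma_gen (P : Type) (Om : P -> Prop) (G : (P -> Prop) -> Prop)
  (A : P -> Prop) :=
  forall S : (P -> Prop) -> Prop,
    (forall X, G X -> S X) ->
    (forall X, S X -> S (fun x => Om x /\ ~ X x)) ->
    (forall F : nat -> P -> Prop, (forall n, S (F n)) ->
       S (fun x => exists n, F n x)) ->
    S A.

Definition cantor_open (U : (nat -> bool) -> Prop) :=
  forall x, U x -> exists N, forall y,
      (forall n, (n < N)%N -> y n = x n) -> U y.

Definition borel_fun (P : Type) (Om : P -> Prop) (Op : (P -> Prop) -> Prop)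
  (f : P -> nat -> bool) :=
  forall X, sigma_gen (fun _ => True) cantor_open X ->
    sigma_gen Om Op (fun p => Om p /\ X (f p)).

Definition smooth (P : Type) (Om : P -> Prop) (Op : (P -> Prop) -> Prop)
  (E : P -> P -> Prop) :=
  exists f : P -> nat -> bool, borel_fun Om Op f /\
    forall p q, Om p -> Om q -> (E p q <-> f p = f q).

Definition ordinal_like (I : Type) (lt : I -> I -> Prop) :=
  well_founded lt /\ (forall x y z, lt x y -> lt y z -> lt x z) /\
  (forall x y, lt x y \/ x = y \/ lt y x).
End FOL.

(* Main.v *)
(* Fix a countable model M.  Conjugates of automorphisms fixing M pointwise
   generate the Lascar strong automorphisms, and the number of generators needed
   to carry a to b is, up to a factor 2, the Lascar distance.  Let Z be the set of
   tuples in Y all of whose finite subtuples are Lascar equivalent to the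
   corresponding ones of a.  In the product topology of the discrete set C, Z is
   a G_delta set, since pseudo open sets are open, so Z is a Baire space; strong
   automorphisms act on it by homeomorphisms and move any cylinder over a given
   finite set of coordinates onto any other.  A Borel reduction of Lascar
   equivalence on Y_M to equality would therefore be constant on a comeager
   set, so some class would be comeager, and one of the closed sets {z : z is
   reached from b in n steps} would contain a cylinder.  As finite subtuples have
   d-bounded classes, boundedly many further steps bring the whole class of b
   into this cylinder.  Since distance at most n is a type-definable condition,
   it is determined by the finite subtuples, and a itself is at bounded distance
   from b: the class of a is d-bounded. *)
Require Import Defs.
From mathcomp Require Import all_boot.
From mathcomp Require Import boolp classical_sets filter.
Set Implicit Arguments.
Unset Strict Implicit.
Unset Printing Implicit Defensive.

(** * Renaming of variables *)

Section Syntax.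
Variable L : language.

Fixpoint tmap X Y (g : X -> Y) (t : term L X) : term L Y :=
  match t with
  | tvar x => tvar L (g x)
  | tapp f ts => tapp (fun i => tmap g (ts i))
  end.

Fixpoint fmap X Y (g : X -> Y) (phi : formula L X) : formula L Y :=
  match phi with
  | fRel r ts => fRel (fun i => tmap g (ts i))
  | fEq t1 t2 => fEq (tmap g t1) (tmap g t2)
  | fNeg psi => fNeg (fmap g psi)
  | fAnd psi chi => fAnd (fmap g psi) (fmap g chi)
  | fEx psi => fEx (fmap (omap g) psi)
  end.

Lemma eval_tmap (C : structure L) X Y (g : X -> Y) (e : Y -> C) t :
  eval e (tmap g t) = eval (e \o g) t.
Proof. by elim: t => //= f ts IH; congr sfun; apply: funext => i; apply: IH. Qed.

Lemma ext_env_omap (C : structure L) X Y (g : X -> Y) (e : Y -> C) m :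
  ext_env e m \o omap g = ext_env (e \o g) m.
Proof. by apply: funext => -[]. Qed.

Lemma sat_fmap (C : structure L) X Y (g : X -> Y) (e : Y -> C) phi :
  sat e (fmap g phi) = sat (e \o g) phi.
Proof.
elim: phi Y g e => {X} /= [X r ts|X t1 t2|X p IH|X p IHp q IHq|X p IH] Y g e.
- by congr srel; apply: funext => i; apply: eval_tmap.
- by rewrite !eval_tmap.
- by rewrite IH.
- by rewrite IHp IHq.
- by congr ex; apply: funext => m; rewrite IH ext_env_omap.
Qed.

Lemma eval_support X (h : X -> nat) (t : term L X) :
  exists N, forall (C : structure L) (e e' : X -> C),
    (forall x, h x < N -> e x = e' x) -> eval e t = eval e' t.
Proof.
elim: t => [x|f ts IH]; first by exists (h x).+1 => C e e' ee'; apply: ee'.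
have [N NP] := choice IH.
exists (\max_i N i) => C e e' ee' /=; congr sfun; apply: funext => i.
by apply: NP => x hx; apply: ee'; apply: leq_trans hx _; apply: leq_bigmax.
Qed.

(** Only finitely many variables occur in a formula. The bound [N] is chosen before the structure,
    so that it serves a model and an elementary submodel alike. *)
Lemma sat_support X (h : X -> nat) (phi : formula L X) :
  exists N, forall (C : structure L) (e e' : X -> C),
    (forall x, h x < N -> e x = e' x) -> sat e phi = sat e' phi.
Proof.
elim: phi h => {X} [X r ts|X t1 t2|X p IH|X p IHp q IHq|X p IH] h.
- have [N NP] := choice (fun i => eval_support h (ts i)).
  exists (\max_i N i) => C e e' ee' /=; congr srel; apply: funext => i.
  by apply: NP => x hx; apply: ee'; apply: leq_trans hx _; apply: leq_bigmax.
- have [N1 P1] := eval_support h t1; have [N2 P2] := eval_support h t2.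
  exists (maxn N1 N2) => C e e' ee' /=.
  by rewrite (P1 _ e e') 1?(P2 _ e e') // => x hx; apply: ee';
     rewrite leq_max hx ?orbT.
- by have [N P] := IH h; exists N => C e e' ee' /=; rewrite (P _ e e').
- have [N1 P1] := IHp h; have [N2 P2] := IHq h.
  exists (maxn N1 N2) => C e e' ee' /=.
  by rewrite (P1 _ e e') 1?(P2 _ e e') // => x hx; apply: ee';
     rewrite leq_max hx ?orbT.
(* Any code will do for the bound variable: both environments give it the same value. *)
- have [N P] := IH (fun o => if o is Some x then h x else 0).
  exists N => C e e' ee' /=; congr ex; apply: funext => m.
  by apply: P => -[x|] //= hx; apply: ee'.
Qed.

(** Rewrites a formula over [X] with variables in a finite ordinal, as parametrised formulas and
    homogeneity demand. The size [N.+1] keeps the target of [r] nonempty. *)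
Lemma finite_retract X (h : X -> nat) (x0 : X) N : injective h ->
  exists (g : 'I_N.+1 -> X) (r : X -> 'I_N.+1),
    forall x, h x < N -> g (r x) = x.
Proof.
move=> hinj.
have [g gP] : exists g : 'I_N.+1 -> X, forall (i : 'I_N.+1) x,
    h x = i -> g i = x.
  have /choice[g gP] : forall i : 'I_N.+1, exists y, forall x, h x = i -> y = x.
    move=> i; have [[y yi]|no] := pselect (exists y, h y = i).
      by exists y => x xi; apply: hinj; rewrite yi.
    by exists x0 => x xi; case: no; exists x.
  by exists g.
exists g, (fun x => inord (h x)) => x hx; apply: gP.
by rewrite inordK // ltnS ltnW.
Qed.

(** Parameters are named by variables in [D] rather than by constants, so that automorphisms and
    changes of parameters act on environments only. *)
Definition senv (Z B D : Type) (a : B -> Z) (d : D -> Z) (z : B + D) : Z :=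
  match z with inl x => a x | inr y => d y end.

Definition smap (B B' D D' : Type) (f : B -> B') (g : D -> D') (z : B + D) :
  B' + D' := match z with inl x => inl (f x) | inr y => inr (g y) end.

Lemma senv_smap Z B B' D D' (f : B -> B') (g : D -> D') (a : B' -> Z) d :
  senv a d \o smap f g = senv (a \o f) (d \o g).
Proof. by apply: funext => -[]. Qed.

Definition upd (Z : Type) (v : nat -> Z) (k : nat) (c : Z) (j : nat) : Z :=
  if j == k then c else v j.

Definition imp X (p q : formula L X) := fNeg (fAnd p (fNeg q)).

Lemma sat_imp (C : structure L) X (e : X -> C) p q :
  sat e (imp p q) <-> (sat e p -> sat e q).
Proof.
split=> /= [H hp|H [hp]]; last by apply; apply: H.
by have [//|nq] := pselect (sat e q); case: H.
Qed.

(** Finite satisfiability of [S] is satisfiability of each member of this closure. *)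
Inductive conj_closure X (S : formula L X -> Prop) : formula L X -> Prop :=
  | conj_base p of S p : conj_closure S p
  | conj_and p q of conj_closure S p & conj_closure S q :
      conj_closure S (fAnd p q).

End Syntax.

(** * Countable types *)

Lemma countable_type_sum X Y : countable_type X -> countable_type Y ->
  countable_type (X + Y).
Proof.
move=> [f fi] [g gi].
exists (fun z => match z with inl x => pickle (true, f x)
                 | inr y => pickle (false, g y) end).
by case=> x [] y /(pcan_inj pickleK) [] // => [/fi|/gi] ->.

Qed.

Lemma countable_type_prod X Y : countable_type X -> countable_type Y ->
  countable_type (X * Y).
Proof.
move=> [f fi] [g gi]; exists (fun z => pickle (f z.1, g z.2)).
by move=> [x y] [x' y'] /(pcan_inj pickleK) /= [] /fi -> /gi ->.
Qed.

Lemma countable_type_nat : countable_type nat.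
Proof. by exists id. Qed.

Lemma countable_type_ord n : countable_type 'I_n.
Proof. by exists val; apply: val_inj. Qed.

Lemma countable_type_image X Z (f : X -> Z) : countable_type X ->
  countable_type {z | exists x, f x = z}.
Proof.
move=> [g gi]; have /choice[r rP] (z : {z | exists x, f x = z}) : exists x, f x = sval z.
  by case: z.
exists (g \o r) => z z' /= /gi zz'; have := rP z; rewrite zz' rP.
case: z z' {zz'} => [z hz] [z' hz'] /= e; subst z'.
by congr exist; apply: Prop_irrelevance.
Qed.

Lemma cantor_not_countable : ~ countable_type (nat -> bool).
Proof.
move=> [g gi].
have [b bP] : exists b : nat -> bool, forall x, b (g x) = ~~ x (g x).
  have /choice[b bP] : forall n, exists b, forall x, g x = n -> b = ~~ x n.
    move=> n; have [[x xn]|no] := pselect (exists x, g x = n).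
      by exists (~~ x n) => y yn; rewrite (gi x y) // xn.
    by exists true => y yn; case: no; exists y.
  by exists b => x; apply: bP.
by have := bP b; case: (b (g b)).
Qed.

(** * Saturation and homogeneity for countably many variables *)

Section Saturation.
Variables (L : language) (K : Type) (C : structure L).
Hypothesis HK : lt_card (nat -> bool) K.

Lemma countable_small (A : C -> Prop) : countable_type {x | A x} -> small K A.
Proof.
move=> [f fi]; case: HK => -[g gi] nK; split.
  exists (fun x => g (fun n => n == f x)) => x y /gi /(congr1 (fun u => u (f x))).
  by rewrite eqxx => /esym/eqP/fi.
move=> [k ki]; apply: cantor_not_countable; exists (fun u => f (k (g u))).
by move=> u v /fi/ki/gi.
Qed.

Hypothesis Hsat : saturated K C.
Hypothesis Hhom : homogeneous K C.

Lemma pform_of_formula (B D : Type) (A : C -> Prop) (d : D -> C) (d0 : D)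
    (phi : formula L (B + D)) :
  countable_type D -> (forall y, A (d y)) ->
  exists p : pform B A, forall a, psat a p = sat (senv a d) phi.
Proof.
move=> [h hi] Ad.
have [N NP] := sat_support (senv (fun=> 0) h) phi.
have [g [r gr]] := finite_retract d0 N hi.
exists (@PForm L B C A _ (fmap (smap id r) phi) (d \o g) (fun i => Ad (g i))).
move=> a; rewrite /psat /= -/(senv a (d \o g)) sat_fmap senv_smap.
by apply: NP => -[//|y /= hy]; rewrite gr.
Qed.

(** Directedness compresses a finite subset of the type to one formula, and [phi0] covers the empty
    subset. It is stated semantically because the projections to which it is applied need not be
    closed under conjunction. *)
Lemma saturated_one (D : Type) (d : D -> C) (d0 : D)
    (S : formula L (unit + D) -> Prop) (phi0 : formula L (unit + D)) :
  countable_type D -> S phi0 ->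
  (forall p q, S p -> S q -> exists2 r, S r & forall c : C,
     sat (senv (fun=> c) d) r -> sat (senv (fun=> c) d) p /\
                                 sat (senv (fun=> c) d) q) ->
  (forall p, S p -> exists c, sat (senv (fun=> c) d) p) ->
  exists c, forall p, S p -> sat (senv (fun=> c) d) p.
Proof.
move=> Dc S0 Sdir Ssat.
pose A c := exists y, d y = c.
have Asm : small K A by apply: countable_small; apply: countable_type_image.
have [n ps psS|c cP] := @Hsat A Asm (fun p => exists2 phi, S phi &
    forall c : C, psat (fun=> c) p = sat (senv (fun=> c) d) phi); last first.
  exists c => phi Sphi.
  have [p pP] := @pform_of_formula unit D A d d0 phi Dc
    (fun y => ex_intro _ y erefl).
  by rewrite -pP; apply: cP; exists phi.
suff [r Sr rP] : exists2 r, S r & forall c : C, sat (senv (fun=> c) d) r ->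
    forall i : 'I_n, psat (fun=> c) (ps i).
  by have [c cr] := Ssat r Sr; exists c => i; apply: rP.
suff H k : k <= n -> exists2 r, S r & forall c : C, sat (senv (fun=> c) d) r ->
    forall i : 'I_n, i < k -> psat (fun=> c) (ps i).
  by have [r Sr rP] := H n (leqnn n); exists r => // c cr i; apply: rP.
elim: k => [|k IH] kn; first by exists phi0.
have [r Sr rP] := IH (ltnW kn).
have [q Sq qP] := psS (Ordinal kn).
have [t St tP] := Sdir _ _ Sr Sq; exists t => // c /tP[cr cq] i.
rewrite ltnS leq_eqVlt => /orP[/eqP ik|]; last exact: rP.
by rewrite (_ : i = Ordinal kn) ?qP //; apply: val_inj.
Qed.

(** Quantifying all variables from [n] on is first-order because [phi] sees only those below some
    [N]: the [N] variables starting at [n] are enough. *)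
Lemma exists_tail (D : Type) (phi : formula L (nat + D)) n :
  exists psi, forall (v : nat -> C) d, sat (senv v d) psi =
    exists2 v', (forall k, k < n -> v' k = v k) & sat (senv v' d) phi.
Proof.
have [N NP] := sat_support (senv id (fun=> 0)) phi.
have [psi psiP] : exists psi, forall (v : nat -> C) d, sat (senv v d) psi =
    exists2 v', (forall k, k < n \/ n + N <= k -> v' k = v k) &
    sat (senv v' d) phi.
  elim: {NP} N => [|N [psi IH]].
    exists phi => v d; rewrite addn0; apply: propext; split=> [H|[v' vv' H]].
      by exists v.
    suff <- : v' = v by [].
    by apply: funext => k; apply: vv'; have [] := ltnP k n; [left|right].
  exists (fEx (fmap (fun z => match z with
    | inl k => if k == n + N then None else Some (inl k)
    | inr y => Some (inr y) end) psi)) => v d /=.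
  have E c : sat (ext_env (senv v d) c) (fmap (fun z => match z with
    | inl k => if k == n + N then None else Some (inl k)
    | inr y => Some (inr y) end) psi) = sat (senv (upd v (n + N) c) d) psi.
    rewrite sat_fmap; congr sat; apply: funext => -[k|y] //=.
    by rewrite /upd; case: eqP.
  apply: propext; split=> [[c]|[v' vv' H]].
    rewrite E IH => -[v' vv' H]; exists v' => // k kn; rewrite vv' /upd.
      by case: eqP kn => // ->; rewrite addnS ltnn ltnNge leq_addr /= => -[].
    by case: kn => kn; [left|right; apply: leq_trans kn; rewrite addnS].
  exists (v' (n + N)); rewrite E IH; exists v' => // k kn.
  rewrite /upd; case: eqP => [->//|/eqP kN]; apply: vv'; case: kn; first by left.
  by move=> kn; right; rewrite addnS ltn_neqAle eq_sym kN.
exists psi => v d; rewrite psiP; apply: propext.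
split=> -[v' vv' H]; first by exists v' => // k kn; apply: vv'; left.
(* Resetting the variables from [n + N] on does not affect [phi]. *)
exists (fun k => if n + N <= k then v k else v' k) => [k|].
  by case: (leqP (n + N) k) => // kn [/vv'|].
rewrite (NP _ _ (senv v' d)) // => -[k|//] /= kN.
by rewrite leqNgt (leq_trans kN) // leq_addl.
Qed.

(** The values are chosen one at a time. The invariant [FS n v] says that the first [n] values of
    [v] extend to a solution of each single formula of [S]; saturation in one variable, applied to
    the projections [S'], preserves it. *)
Lemma saturated_nat (D : Type) (d : D -> C) (S : formula L (nat + D) -> Prop) :
  countable_type D ->
  (forall p q, S p -> S q -> S (fAnd p q)) ->
  (forall p, S p -> exists v : nat -> C, sat (senv v d) p) ->
  exists v : nat -> C, forall p, S p -> sat (senv v d) p.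
Proof.
move=> Dc Sand Ssat.
have [[phi0 S0]|S0] := pselect (exists p, S p); last first.
  by exists (fun=> Defs.point C) => p Sp; case: S0; exists p.
pose FS n (v : nat -> C) := forall p, S p ->
  exists2 v', (forall k, k < n -> v' k = v k) & sat (senv v' d) p.
have step (nv : nat * (nat -> C)) : exists c,
    FS nv.1 nv.2 -> FS nv.1.+1 (upd nv.2 nv.1 c).
  case: nv => n v /=.
  have [FSn|] := pselect (FS n v); last by exists (Defs.point C).
  pose S' (t : formula L (unit + (nat + D))) := exists2 p, S p &
    forall c, sat (senv (fun=> c) (senv v d)) t =
      exists2 v', (forall k, k < n.+1 -> v' k = upd v n c k) &
                  sat (senv v' d) p.
  have S'ex p : S p -> exists2 t, S' t &
    forall c, sat (senv (fun=> c) (senv v d)) t =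
      exists2 v', (forall k, k < n.+1 -> v' k = upd v n c k) &
                  sat (senv v' d) p.
    move=> Sp; have [psi psiP] := exists_tail p n.+1.
    pose t := fmap (fun z => match z with
      | inl k => if k == n then inl tt else inr (inl k)
      | inr y => inr (inr y) end) psi.
    have tP c : sat (senv (fun=> c) (senv v d)) t =
      exists2 v', (forall k, k < n.+1 -> v' k = upd v n c k) &
                  sat (senv v' d) p.
      rewrite -psiP sat_fmap; congr sat; apply: funext => -[k|y] //=.
      by rewrite /upd; case: eqP.
    by exists t => //; exists p.
  have [t0 S't0 _] := S'ex _ S0.
  have [|//|p q [p' Sp pP] [q' Sq qP]|p [p' Sp pP]|c cP] :=
    @saturated_one (nat + D)%type (senv v d) (inl 0) S' t0.
  - exact: countable_type_sum countable_type_nat Dc.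
  - have [t S't tP] := S'ex _ (Sand _ _ Sp Sq); exists t => // c.
    by rewrite tP pP qP => -[v' vv' /= [H1 H2]]; split; exists v'.
  - have [v' vv' H] := FSn p' Sp; exists (v' n); rewrite pP.
    exists v' => // k; rewrite ltnS leq_eqVlt /upd.
    by case: eqP => [->|] //= _; apply: vv'.
  exists c => _ p Sp.
  have [t S't tP] := S'ex p Sp.
  by have := cP t S't; rewrite tP.
have [c cP] := choice step.
pose vs := fix vs n := if n is n'.+1 then upd (vs n') n' (c (n', vs n'))
                       else (fun=> Defs.point C).
have FSvs n : FS n (vs n).
  elim: n => [p Sp|n IH]; last exact: cP (n, vs n) IH.
  by have [v H] := Ssat p Sp; exists v.
have vsP n k : k < n -> vs n k = vs k.+1 k.
  elim: n => // n IH; rewrite ltnS leq_eqVlt => /orP[/eqP->//|kn] /=.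
  by rewrite {1}/upd ltn_eqF // IH.
exists (fun k => vs k.+1 k) => p Sp.
have [N NP] := sat_support (senv id (fun=> 0)) p.
have [v' vv' H] := FSvs N p Sp.
rewrite (NP _ _ (senv v' d)) // => -[k|//] /= kN.
by rewrite vv' // vsP.
Qed.

Lemma extend_along (V : Type) (g : V -> nat) (v : V -> C) : injective g ->
  exists w : nat -> C, w \o g = v.
Proof.
move=> gi; have /choice[w wP] : forall n, exists c, forall x, g x = n -> c = v x.
  move=> n; have [[x xn]|no] := pselect (exists x, g x = n).
    by exists (v x) => y yn; rewrite (gi x y) // xn.
  by exists (Defs.point C) => x xn; case: no; exists x.
by exists w; apply: funext => x; apply: wP.
Qed.

Lemma countably_saturated (V D : Type) (d : D -> C)
    (S : formula L (V + D) -> Prop) :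
  countable_type V -> countable_type D ->
  (forall p, conj_closure S p -> exists v : V -> C, sat (senv v d) p) ->
  exists v : V -> C, forall p, S p -> sat (senv v d) p.
Proof.
move=> [g gi] Dc Ssat.
have [//|p q [p' Sp ->] [q' Sq ->]|p [p' Sp ->]|v vP] := @saturated_nat D d
    (fun p => exists2 q, conj_closure S q & p = fmap (smap g id) q).
- by exists (fAnd p' q') => //; apply: conj_and.
- have [v H] := Ssat p' Sp; have [w wv] := extend_along v gi.
  by exists w; rewrite sat_fmap senv_smap wv.
- exists (v \o g) => p Sp.
  have := vP (fmap (smap g id) p); rewrite sat_fmap senv_smap; apply.
  by exists p => //; apply: conj_base.
Qed.

(** Negation makes one direction enough, and transfer of equalities makes the map from [a] to [b]
    well defined on the range of [a]; elsewhere it is taken to be the identity. *)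
Lemma countably_homogeneous (D : Type) (a b : D -> C) : countable_type D ->
  (forall phi : formula L D, sat a phi -> sat b phi) ->
  exists2 s : C -> C, automorphism s & s \o a = b.
Proof.
move=> Dc ab.
have ab' phi : sat a phi <-> sat b phi.
  split; first exact: ab.
  have [//|na bphi] := pselect (sat a phi).
  by case: (ab (fNeg phi)).
pose A c := exists y, a y = c.
have Asm : small K A by apply: countable_small; apply: countable_type_image.
have [g gP] : exists g : C -> C, forall y, g (a y) = b y.
  have /choice[g gP] : forall c, exists c', forall y, a y = c -> b y = c'.
    move=> c; have [[y yc]|no] := pselect (A c).
      exists (b y) => z zc.
      by apply: (ab (fEq (tvar L z) (tvar L y))); rewrite /= zc yc.
    by exists c => y yc; case: no; exists y.
  by exists g => y; rewrite (gP (a y) y).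
have [n phi x xA|s [sa sP]] := Hhom Asm (g := g); last first.
  by exists s => //; apply: funext => y; rewrite /= sP ?gP //; exists y.
have [y yx] := choice xA.
have -> : x = a \o y by apply: funext => i; rewrite /= yx.
have -> : g \o (a \o y) = b \o y by apply: funext => i; rewrite /= gP.
by rewrite -(sat_fmap y a) -(sat_fmap y b).
Qed.
End Saturation.

(** * Strong automorphisms *)

Section Automorphisms.
Variables (L : language) (C : structure L).
Implicit Types s t : C -> C.

Lemma automorphism_id : automorphism (id : C -> C).
Proof. by split; [exists id|]. Qed.

Lemma automorphism_comp s t :
  automorphism s -> automorphism t -> automorphism (s \o t).
Proof.
move=> [bs [fs rs]] [bt [ft rt]]; split; first exact: bij_comp.
split=> [f args|r args] /=; first by rewrite ft fs.
by rewrite -(rt r args) -(rs r (t \o args)).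
Qed.

Lemma automorphism_inv s : automorphism s ->
  exists t, [/\ automorphism t, cancel s t & cancel t s].
Proof.
move=> [[t st ts] [fs rs]]; exists t; split=> //; split; first by exists s.
have E X (u : X -> C) : s \o (t \o u) = u by apply: funext => x /=; rewrite ts.
split=> [f args|r args]; first by apply: (can_inj st); rewrite ts fs E.
by rewrite -(rs r (t \o args)) E.
Qed.

Lemma eval_automorphism s X (e : X -> C) (t : term L X) : automorphism s ->
  eval (s \o e) t = s (eval e t).
Proof.
move=> [_ [fs _]]; elim: t => //= f ts IH; rewrite fs; congr sfun.
by apply: funext => i; apply: IH.
Qed.

Lemma sat_automorphism s X (e : X -> C) (phi : formula L X) : automorphism s ->
  sat (s \o e) phi = sat e phi.
Proof.
move=> sa; have [[s' ss' s's] [_ rs]] := sa.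
have E X' (u : X' -> C) (ts : term L X') : eval (s \o u) ts = s (eval u ts).
  exact: eval_automorphism.
elim: phi e => {X} /= [X r ts|X t1 t2|X p IH|X p IHp q IHq|X p IH] e.
- have -> : (fun i => eval (s \o e) (ts i)) = s \o (fun i => eval e (ts i)).
    by apply: funext => i; rewrite E.
  exact/propext/rs.
- rewrite !E; apply: propext; split=> [|->//]; exact: can_inj.
- by rewrite IH.
- by rewrite IHp IHq.
- have F m : ext_env (s \o e) (s m) = s \o ext_env e m.
    by apply: funext => -[].
  apply: propext; split=> -[m]; last by exists (s m); rewrite F IH.
  by rewrite -(s's m) F IH => ?; exists (s' m).
Qed.

Lemma senv_comp B D s (a : B -> C) (d : D -> C) :
  s \o senv a d = senv (s \o a) (s \o d).
Proof. by apply: funext => -[]. Qed.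

Variable M : C -> Prop.

(* The conjugates of the automorphisms fixing the model [M] pointwise; they
   generate the group of Lascar strong automorphisms. *)
Definition strong1 s := automorphism s /\
  exists2 t, automorphism t & forall x, M x -> s (t x) = t x.

Fixpoint strong n s : Prop :=
  if n is n'.+1 then exists s1 s2, [/\ strong n' s1, strong1 s2 & s = s2 \o s1]
  else s = id.

Lemma strong1_id : strong1 id.
Proof.
by split; [exact: automorphism_id|exists id => //; exact: automorphism_id].
Qed.

Lemma strong1_inv s : strong1 s ->
  exists t, [/\ strong1 t, cancel s t & cancel t s].
Proof.
move=> [sa [t ta tP]]; have [s' [s'a ss' s's]] := automorphism_inv sa.
by exists s'; split=> //; split=> //; exists t => // x Mx; rewrite -{1}tP.
Qed.

Lemma strong_comp n k s t : strong n s -> strong k t -> strong (k + n) (t \o s).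
Proof.
move=> Hs; elim: k t => [t ->//|k IH t [t1 [t2 [/IH H1 H2 ->]]]].
by exists (t1 \o s), t2.
Qed.

Lemma strong_inv n s : strong n s ->
  exists t, [/\ strong n t, cancel s t & cancel t s].
Proof.
elim: n s => [s ->|n IH s [s1 [s2 [/IH[t1 [H1 c1 c1']] H2 ->]]]].
  by exists id.
have [t2 [K2 c2 c2']] := strong1_inv H2.
exists (t1 \o t2); split; [|exact: can_comp..].
rewrite -addn1; apply: strong_comp H1.
by exists id, t2; split.
Qed.

(** The factorisation becomes an infinite sequence, constant from [n] on, so that no bound on the
    index has to be carried along. *)
Lemma strong_chain n s : strong n s -> exists r : nat -> C -> C,
  [/\ r 0 = id, r n = s & forall i, exists2 s', strong1 s' & r i.+1 = s' \o r i].
Proof.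
elim: n s => [s ->|n IH s [s1 [s2 [/IH[r [r0 rn rS]] H2 ->]]]].
  by exists (fun=> id); split=> // i; exists id => //; exact: strong1_id.
exists (fun i => if i <= n then r i else s2 \o s1).
split=> [||i]; rewrite ?leq0n ?ltnn //.
case: (ltngtP i n) => [_|ni|->]; first exact: rS.
  by exists id => //; exact: strong1_id.
by exists s2 => //; rewrite rn.
Qed.

End Automorphisms.

(** * Lascar distance bounds the number of generators *)

Section LascarStrong.
Variables (L : language) (K : Type) (C : structure L) (M : C -> Prop).
Hypothesis HK : lt_card (nat -> bool) K.
Hypothesis Hsat : saturated K C.
Hypothesis Hhom : homogeneous K C.
Hypothesis Mc : countable_type {x | M x}.
Let m : {x | M x} -> C := sval.

(* [p] enumerates a conjugate of [M] over which [a] and [b] have the same type. *)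
Lemma strong1_of_types B (a b : B -> C) (p : {x | M x} -> C) :
  countable_type B ->
  (forall phi : formula L {x | M x}, sat m phi -> sat p phi) ->
  (forall psi : formula L (B + {x | M x}),
     sat (senv a p) psi -> sat (senv b p) psi) ->
  exists2 s, strong1 M s & s \o a = b.
Proof.
move=> Bc mp ab.
have [t ta tm] := countably_homogeneous HK Hhom Mc mp.
have [s sa sab] := countably_homogeneous HK Hhom (countable_type_sum Bc Mc) ab.
have sE z : s (senv a p z) = senv b p z by rewrite -sab.
exists s; last by apply: funext => x; exact: (sE (inl x)).
split=> //; exists t => // x Mx.
have -> : t x = p (exist _ x Mx) by rewrite -tm.
exact: (sE (inr (exist _ x Mx))).
Qed.

Definition infinite_pred (P : nat -> Prop) := forall N, exists2 n, N <= n & P n.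

Lemma infinite_pred_split P R : infinite_pred P ->
  infinite_pred (fun n => P n /\ R n) \/ infinite_pred (fun n => P n /\ ~ R n).
Proof.
move=> Pinf; have [|nR] := pselect (infinite_pred (fun n => P n /\ R n)).
  by left.
right=> N; have [N0 HN0] : exists N0, forall n, N0 <= n -> P n -> ~ R n.
  apply: contrapT => no; apply: nR => k; apply: contrapT => no'; apply: no.
  by exists k => n kn Pn Rn; apply: no'; exists n.
have [n] := Pinf (maxn N N0); rewrite geq_max => /andP[Nn N0n] Pn.
by exists n => //; split=> //; apply: HN0.
Qed.

Lemma increasing_pair p q : p < q ->
  increasing (fun k : 'I_2 => if k == ord0 then p else q).
Proof.
by move=> pq [[|[|k]] hk] [[|[|l]] hl].
Qed.

(* Two of infinitely many elements of an indiscernible sequence satisfy the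
   same formulas from a given finite set of formulas over [M]; by
   indiscernibility and saturation a conjugate of [M] does this for all
   formulas at once. *)
Lemma indiscernible_strong1 B (e : nat -> B -> C) i j : countable_type B ->
  indiscernible e -> i < j -> exists2 s, strong1 M s & s \o e i = e j.
Proof.
move=> Bc ind ij.
pose fa (z : B + {x | M x}) : {x | M x} + (B + B) :=
  match z with inl x => inr (inl x) | inr d => inl d end.
pose fb (z : B + {x | M x}) : {x | M x} + (B + B) :=
  match z with inl x => inr (inr x) | inr d => inl d end.
have faE d a b : senv d (senv a b) \o fa = senv a d :> (_ -> C).
  by apply: funext => -[].
have fbE d a b : senv d (senv a b) \o fb = senv b d :> (_ -> C).
  by apply: funext => -[].
(* The first kind of formula makes the solution a conjugate of [M]; the second gives [e i] and [e j]
   the same type over it. *)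
pose S (chi : formula L ({x | M x} + (B + B))) :=
  (exists2 phi, sat m phi & chi = fmap inl phi) \/
  (exists psi, chi = imp (fmap fa psi) (fmap fb psi)).
(* Each conjunct thins the index set: either the indices where [psi] holds or those where it fails
   are infinitely many, and the implication holds between any two of them. The conjugate is [m]
   itself here. *)
have Sfs chi : conj_closure S chi -> forall P, infinite_pred P ->
    exists2 Q, infinite_pred Q /\ (forall n, Q n -> P n) &
    forall p q, p < q -> Q p -> Q q -> sat (senv m (senv (e p) (e q))) chi.
  elim=> [{}chi [[phi mphi ->]|[psi ->]]|c1 c2 _ IH1 _ IH2] P Pinf.
  - by exists P => // p q _ _ _; rewrite sat_fmap.
  - have [Qinf|Qinf] :=
      infinite_pred_split (fun n => sat (senv (e n) m) psi) Pinf.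
    + exists (fun n => P n /\ sat (senv (e n) m) psi).
        by split=> // n [].
      move=> p q _ _ [_ Hq]; apply/sat_imp => _.
      by rewrite sat_fmap fbE.
    + exists (fun n => P n /\ ~ sat (senv (e n) m) psi).
        by split=> // n [].
      move=> p q _ [_ Hp] _; apply/sat_imp.
      by rewrite sat_fmap faE.
  - have [Q1 [Q1inf Q1P] H1] := IH1 P Pinf.
    have [Q2 [Q2inf Q2Q1] H2] := IH2 Q1 Q1inf.
    exists Q2; first by split=> // n /Q2Q1/Q1P.
    by move=> p q pq Qp Qq; split; [apply: H1 => //; apply: Q2Q1|apply: H2].
have [|p pP] := countably_saturated HK Hsat (d := senv (e i) (e j)) (S := S) Mc
  (countable_type_sum Bc Bc).
  move=> chi Schi.
  have [Q [Qinf _] HQ] := Sfs chi Schi (fun=> True) (fun N =>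
    ex_intro2 _ _ N (leqnn N) Logic.I).
  have [p _ Qp] := Qinf 0; have [q pq Qq] := Qinf p.+1.
  (* An automorphism takes the pair [e p], [e q] to [e i], [e j], and [m] to the desired witness. *)
  have [|t ta tP] := @countably_homogeneous _ _ _ HK Hhom (B + B)%type
     (senv (e p) (e q)) (senv (e i) (e j)) (countable_type_sum Bc Bc).
    move=> phi.
    pose f (z : B + B) : 'I_2 * B :=
      match z with inl x => (ord0, x) | inr x => (ord_max, x) end.
    have /= := ind 2 (fmap f phi) _ _ (increasing_pair pq) (increasing_pair ij).
    rewrite !sat_fmap.
    have E k l : (fun z => e (if z.1 == ord0 then k else l) z.2) \o f =
       senv (e k) (e l) by apply: funext => -[].
    by rewrite !E => -[].
  by exists (t \o m); rewrite -tP -senv_comp sat_automorphism //; exact: HQ.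
apply: (@strong1_of_types B _ _ p) => // [phi mphi|psi].
  have := pP (fmap inl phi); rewrite sat_fmap; apply.
  by left; exists phi.
have /pP/sat_imp : S (imp (fmap fa psi) (fmap fb psi)) by right; exists psi.
by rewrite !sat_fmap faE fbE.
Qed.

(** Each edge costs one generator. Its ends may occur in the sequence in either order, hence the
    inverse. *)
Lemma ldist_le_strong B n (a b : B -> C) : countable_type B ->
  ldist_le n a b -> exists2 s, strong M n s & s \o a = b.
Proof.
move=> Bc; elim: n b => [b <-|n IH b /= [c [/IH[s ss <-] H]]]; first by exists id.
suff [t ts tb] : exists2 t, strong1 M t & t \o (s \o a) = b.
  by exists (t \o s) => //; exists s, t.
case: H => [->|[_ [e [ind [i [j [ei ej]]]]]]].
  by exists id => //; exact: strong1_id.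
case: (ltngtP i j) => [ij|ji|ij].
- by rewrite -ei -ej; exact: indiscernible_strong1.
- have [t /strong1_inv[t' [t's tt' t't]] te] := indiscernible_strong1 Bc ind ji.
  by exists t' => //; rewrite -ei -ej -te; apply: funext => x /=; rewrite tt'.
- by exists id; [exact: strong1_id|rewrite -ei -ej ij].
Qed.

(* Being joined by an [n]-step strong automorphism is a type-definable
   relation, hence determined by the finite subtuples. *)
Lemma strong_finite_character B (h : B -> nat) n (a b : B -> C) : injective h ->
  (forall N, exists2 s, strong M n s & forall x, h x < N -> s (a x) = b x) ->
  exists2 s, strong M n s & s \o a = b.
Proof.
move=> hi HN; have Bc : countable_type B by exists h.
(* The variables [(i, inl x)] form the tuple after [i] steps, and the [(i, inr d)] a conjugate of
   [M] over which tuples [i] and [i.+1] have the same type. *)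
pose V := (nat * (B + {x | M x}))%type.
pose f0 i (z : B + {x | M x}) : V + (B + B) := inl (i, z).
pose f1 i (z : B + {x | M x}) : V + (B + B) :=
  inl (match z with inl x => (i.+1, inl x) | inr d => (i, inr d) end).
pose S (chi : formula L (V + (B + B))) :=
  [\/ exists x, chi = fEq (tvar L (inl (0, inl x))) (tvar L (inr (inl x))),
      exists x, chi = fEq (tvar L (inl (n, inl x))) (tvar L (inr (inr x))),
      exists i phi, sat m phi /\ chi = fmap (fun d => inl (i, inr d)) phi |
      exists i psi, chi = imp (fmap (f0 i) psi) (fmap (f1 i) psi)].
pose vof (r t : nat -> C -> C) (z : V) : C :=
  match z with (i, inl x) => r i (a x) | (i, inr d) => t i (m d) end.
(* Only the formulas tying tuple [n] to [b] need the chain to end correctly, and a conjunction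
   contains finitely many of them. *)
have Sfs chi : conj_closure S chi -> exists N, forall r t : nat -> C -> C,
    r 0 = id -> (forall x, h x < N -> r n (a x) = b x) ->
    (forall i, automorphism (t i)) ->
    (forall i, exists s, [/\ automorphism s, forall x, M x -> s (t i x) = t i x &
       r i.+1 = s \o r i]) ->
    sat (senv (vof r t) (senv a b)) chi.
  elim=> [{}chi Schi|c1 c2 _ [N1 H1] _ [N2 H2]]; last first.
    exists (maxn N1 N2) => r t r0 rn ta rS; split; [apply: H1|apply: H2] => //;
      by move=> x hx; apply: rn; rewrite leq_max hx ?orbT.
  case: Schi => [[x ->]|[x ->]|[i [phi [mphi ->]]]|[i [psi ->]]].
  - by exists 0 => r t r0 rn ta rS /=; rewrite r0.
  - by exists (h x).+1 => r t r0 rn ta rS /=; apply: rn.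
  - exists 0 => r t r0 rn ta rS; rewrite sat_fmap.
    by rewrite -[sat _ _]/(sat (t i \o m) phi) sat_automorphism.
  - exists 0 => r t r0 rn ta rS; apply/sat_imp; rewrite !sat_fmap.
    have [s [sa sM rE]] := rS i.
    rewrite -(sat_automorphism _ _ sa) -[X in X -> _]/(sat _ psi).
    rewrite (_ : s \o _ = senv (vof r t) (senv a b) \o f1 i) //.
    by apply: funext => -[x|d] /=; rewrite ?rE // sM //; exact: (svalP d).
have [|||v vP] := @countably_saturated _ _ _ HK Hsat V (B + B)%type (senv a b) S.
- exact: countable_type_prod countable_type_nat (countable_type_sum Bc Mc).
- exact: countable_type_sum.
- move=> chi /Sfs[N H]; have [s /strong_chain[r [r0 rn rS]] sN] := HN N.
  have /choice[t tP] i : exists t, automorphism t /\ exists s,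
      [/\ automorphism s, forall x, M x -> s (t x) = t x & r i.+1 = s \o r i].
    by have [s' [s'a [t ta tP]] rE] := rS i; exists t; split=> //; exists s'.
  exists (vof r t); apply: H => // [x|i|i]; first by rewrite rn; exact: sN.
    by have [] := tP i.
  by have [] := tP i.
pose c i x := v (i, inl x).
have ca : c 0 = a.
  apply: funext => x.
  by apply: (vP (fEq (tvar L (inl (0, inl x))) (tvar L (inr (inl x)))));
    apply: Or41; exists x.
have cb : c n = b.
  apply: funext => x.
  by apply: (vP (fEq (tvar L (inl (n, inl x))) (tvar L (inr (inr x)))));
    apply: Or42; exists x.
have cS i : exists2 s, strong1 M s & s \o c i = c i.+1.
  apply: (@strong1_of_types B _ _ (fun d => v (i, inr d))) => // [phi mphi|psi].
    have := vP (fmap (fun d => inl (i, inr d)) phi); rewrite sat_fmap; apply.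
    by apply: Or43; exists i, phi.
  have /vP/sat_imp : S (imp (fmap (f0 i) psi) (fmap (f1 i) psi)).
    by apply: Or44; exists i, psi.
  rewrite !sat_fmap.
  have E0 : senv v (senv a b) \o f0 i = senv (c i) (fun d => v (i, inr d)).
    by apply: funext => -[].
  have E1 : senv v (senv a b) \o f1 i = senv (c i.+1) (fun d => v (i, inr d)).
    by apply: funext => -[].
  by rewrite E0 E1.
rewrite -ca -cb; elim: (n) => [|k [s ss sE]]; first by exists id.
have [t ts tE] := cS k.
by exists (t \o s); [exists s, t|rewrite -tE -sE].
Qed.

End LascarStrong.

(** * Coheirs *)

Section Coheirs.
Variables (L : language) (K : Type) (C : structure L) (M : C -> Prop).
Hypothesis HK : lt_card (nat -> bool) K.
Hypothesis Hsat : saturated K C.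
Hypothesis Mc : countable_type {x | M x}.
Hypothesis Mel : elementary_sub M.
Let m : {x | M x} -> C := sval.

(** Elementarity is given for formulas over finite ordinals; finite support extends it to formulas
    naming all of [M]. *)
Lemma tarski_vaught (phi : formula L (option {x | M x})) :
  (exists c, sat (ext_env m c) phi) -> exists d, sat (ext_env m (m d)) phi.
Proof.
have [m0 [Hcl el]] := Mel; have [g gi] := Mc.
have E X (f : X -> nat) (x0 : X) (u : X -> {x | M x}) (psi : formula L X) :
    injective f -> sat (M := induced m0 Hcl) u psi <-> sat (m \o u) psi.
  move=> fi; have [N NP] := sat_support f psi.
  have [k [r kr]] := finite_retract x0 N fi.
  have := el _ (fmap r psi) (u \o k); rewrite !sat_fmap.
  rewrite (NP (induced m0 Hcl) ((u \o k) \o r) u) => [|x /kr /= -> //].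
  by rewrite (NP _ _ (m \o u)) // => x /kr /= ->.
move=> H; have /(E _ g m0 id (fEx phi) gi)[d] : sat (m \o id) (fEx phi) by [].
(* The shift reserves code [0] for the bound variable and keeps the coding injective. *)
move/(E _ (fun o => if o is Some x then (g x).+1 else 0) None) => H'.
exists d; have -> : ext_env m (m d) = m \o ext_env (M := induced m0 Hcl) id d.
  by apply: funext => -[].
by apply: H' => -[x|] [y|] //= [] /gi ->.
Qed.

Variables (B : Type) (h : B -> nat).
Hypothesis hi : injective h.

(** Coordinates move into [M] one by one: the coordinate of code [N] is quantified away, the
    induction treats the others, and a witness in [M] is then found for it. *)
Lemma type_finitely_satisfiable (a : B -> C) (phi : formula L (B + {x | M x})) :
  sat (senv a m) phi -> exists t : B -> {x | M x}, sat (senv (m \o t) m) phi.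
Proof.
have [N NP] := sat_support (senv h (fun=> 0)) phi.
have {}NP (u v : B -> C) d : (forall x, h x < N -> u x = v x) ->
    sat (senv u d) phi = sat (senv v d) phi.
  by move=> uv; apply: NP => -[x /uv|].
have [w wa] := extend_along a hi.
elim: N phi NP => [|N IH] phi NP H.
  have [m0 _] := Mel; exists (fun=> m0).
  by rewrite (NP _ a).
pose f z : option (B + {x | M x}) :=
  match z with inl x => if h x == N then None else Some (inl x)
             | inr d => Some (inr d) end.
have fE u c d : ext_env (senv u d) c \o f =
    senv (fun x => if h x == N then c else u x) d :> (_ -> C).
  by apply: funext => -[x|] //=; case: eqP.
have [u v d uv||t /= [c]] := IH (fEx (fmap f phi)).
- rewrite /=; congr ex; apply: funext => c; rewrite !sat_fmap !fE.
  apply: NP => x; rewrite ltnS leq_eqVlt.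
  by case: eqP => //= _; apply: uv.
- exists (w N); rewrite sat_fmap fE; move: H; congr (sat (senv _ m) phi).
  by apply: funext => x; case: eqP => // <-; rewrite -wa.
rewrite sat_fmap fE.
pose g z : option {x | M x} :=
  match z with inl x => if h x == N then None else Some (t x)
             | inr d => Some d end.
have gE c' : ext_env m c' \o g =
    senv (fun x => if h x == N then c' else m (t x)) m.
  by apply: funext => -[x|] //=; case: eqP.
move=> Hc; have [|d] := @tarski_vaught (fmap g phi).
  by exists c; rewrite sat_fmap gE.
rewrite sat_fmap gE => Hd.
exists (fun x => if h x == N then d else t x); move: Hd.
by congr (sat (senv _ m) phi); apply: funext => x /=; case: eqP.
Qed.

(* The global coheir of [tp(a/M)] given by [U] is the limit along [U] of the
   types of the tuples of [M]. *)
Lemma coheir_ultrafilter (a : B -> C) :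
  exists U : set_system (B -> {x | M x}), UltraFilter U /\
    forall phi : formula L (B + {x | M x}),
      sat (senv a m) phi -> U (fun t => sat (senv (m \o t) m) phi).
Proof.
pose F (A : set (B -> {x | M x})) := exists2 phi, sat (senv a m) phi &
  forall t, sat (senv (m \o t) m) phi -> A t.
have [|U [Uu FU]] := @ultraFilterLemma _ F; last first.
  by exists U; split=> // phi H; apply: FU; exists phi.
split; first by move=> [phi /type_finitely_satisfiable[t Ht] /(_ t Ht)].
have [m0 _] := Mel.
split.
- exists (fEq (tvar L (inr m0)) (tvar L (inr m0))) => //.
- move=> A A' [p Hp pA] [q Hq qA']; exists (fAnd p q) => //= t [/pA At /qA'].
  by split.
- by move=> A A' AA' [p Hp pA]; exists p => // t /pA /AA'.
Qed.

(** * Morley sequences of a coheir *)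

Section Morley.
Variable U : set_system (B -> {x | M x}).
Hypothesis Uu : UltraFilter U.

(** The formulas holding [U]-almost everywhere are closed under conjunction, and each is satisfied
    by a tuple of [M] since sets in [U] are nonempty. *)
Lemma coheir_realized (D : Type) (d : D -> C) : countable_type D ->
  exists c : B -> C, forall phi : formula L (B + (D + {x | M x})),
    U (fun t => sat (senv (m \o t) (senv d m)) phi) ->
    sat (senv c (senv d m)) phi.
Proof.
move=> Dc; apply: (countably_saturated HK Hsat) => [||phi Hphi].
- by exists h.
- exact: countable_type_sum.
suff : U (fun t => sat (senv (m \o t) (senv d m)) phi).
  by move=> /filter_ex[t Ht]; exists (m \o t).
by elim: Hphi => // p q _ Hp _ Hq; apply: filterS (filterI Hp Hq).
Qed.

(** The tuple [c] realises the restriction to [M] and [e] of the global coheir given by [U]. *)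
Definition realizes_over n (e : 'I_n -> B -> C) (c : B -> C) :=
  forall phi : formula L (B + ('I_n * B + {x | M x})),
    U (fun t => sat (senv (m \o t) (senv (fun z => e z.1 z.2) m)) phi) ->
    sat (senv c (senv (fun z => e z.1 z.2) m)) phi.

Lemma realizes_overE n (e : 'I_n -> B -> C) c phi : realizes_over e c ->
  U (fun t => sat (senv (m \o t) (senv (fun z => e z.1 z.2) m)) phi) <->
  sat (senv c (senv (fun z => e z.1 z.2) m)) phi.
Proof.
move=> H; split; first exact: H.
have [//|nU] := in_ultra_setVsetC
  (fun t => sat (senv (m \o t) (senv (fun z => e z.1 z.2) m)) phi) Uu.
by have := H (fNeg phi) nU.
Qed.

(** Indiscernibility over [M] is proved by induction on the number of tuples: the last one is
    replaced by [U]-almost all tuples [t] of [M], which become parameters for the shorter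
    formula. *)
Lemma morley_indiscernible (e : nat -> B -> C) :
  (forall p n (i : 'I_n -> nat), (forall q, i q < p) ->
     realizes_over (e \o i) (e p)) ->
  indiscernible e.
Proof.
move=> He.
suff ind n (i j : 'I_n -> nat) phi : increasing i -> increasing j ->
    sat (senv (fun z => e (i z.1) z.2) m) phi ->
    sat (senv (fun z => e (j z.1) z.2) m) phi.
  move=> n phi i j iinc jinc; have := ind n _ _ (fmap inl phi).
  by move=> H; split; [have := H i j|have := H j i]; rewrite !sat_fmap; apply.
elim: n i j phi => [|n IH] i j phi iinc jinc.
  congr (sat (senv _ m) phi).
  by apply: funext => -[[]].
pose f (z : 'I_n.+1 * B + {x | M x}) : B + ('I_n * B + {x | M x}) :=
  match z with
  | inl (q, x) => if unlift ord_max q is Some q' then inr (inl (q', x))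
                  else inl x
  | inr d => inr (inr d) end.
pose tl (k : 'I_n.+1 -> nat) q := k (lift ord_max q).
have fE (k : 'I_n.+1 -> nat) :
    senv (e (k ord_max)) (senv (fun z => (e \o tl k) z.1 z.2) m) \o f =
    senv (fun z => e (k z.1) z.2) m.
  apply: funext => -[[q x]|] //=.
  by case: unliftP => [q' ->|->].
have tl_inc k : increasing k -> increasing (tl k).
  by move=> kinc p q pq; apply: kinc; rewrite !lift_max.
have tl_max k : increasing k -> forall q, tl k q < k ord_max.
  by move=> kinc q; apply: kinc; rewrite lift_max; exact: ltn_ord.
rewrite -!fE -!sat_fmap.
move/(realizes_overE _ (He _ _ _ (tl_max i iinc))) => H.
apply/(realizes_overE _ (He _ _ _ (tl_max j jinc))); apply: filterS H => t.
pose g z : 'I_n * B + {x | M x} := match z with inl x => inr (t x) | inr z => z end.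
have gE (k : 'I_n.+1 -> nat) : senv (m \o t) (senv (fun z => (e \o tl k) z.1 z.2) m) =
    senv (fun z => e (tl k z.1) z.2) m \o g.
  by apply: funext => -[].
by rewrite !gE -!(sat_fmap g); apply: IH; apply: tl_inc.
Qed.

(** The first two entries are arbitrary; the tail realises the coheir over both, so that it can
    continue either of them. *)
Lemma morley_sequence (a b : B -> C) : exists c : nat -> B -> C,
  [/\ c 0 = a, c 1 = b & forall p n (i : 'I_n -> nat),
      (forall q, i q < p.+2) -> realizes_over (c \o i) (c p.+2)].
Proof.
have /choice[st stP] (H : nat -> B -> C) := @coheir_realized (nat * B)%type
  (fun z => H z.1 z.2) (countable_type_prod countable_type_nat (ex_intro _ h hi)).
(* At stage [k] the entries up to [k.+1] are final; later ones hold the placeholder [a]. *)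
pose G := fix G k : nat -> B -> C :=
  if k is k'.+1 then upd (G k') k'.+2 (st (G k')) else upd (fun=> a) 1 b.
have GE k j : j <= k.+1 -> G k j = G j j.
  elim: k => [|k IH]; first by case: j => [|[|]].
  rewrite leq_eqVlt => /orP[/eqP->|jk].
    by rewrite /= [RHS]/upd ltn_eqF.
  by rewrite -IH // /= /upd ltn_eqF.
exists (fun j => G j j); split=> // p n i ip phi.
have -> : (fun z : 'I_n * B => ((fun j => G j j) \o i) z.1 z.2) =
    fun z => G p (i z.1) z.2.
  by apply: funext => z /=; rewrite GE //; exact: ip.
have -> : G p.+2 p.+2 = st (G p).
  by rewrite -(GE p.+1) //= /upd eqxx.
pose f (z : B + ('I_n * B + {x | M x})) : B + (nat * B + {x | M x}) :=
  match z with
  | inl x => inl x | inr (inr d) => inr (inr d)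
  | inr (inl (q, x)) => inr (inl (i q, x)) end.
have fE u : senv u (senv (fun z => G p (i z.1) z.2) m) =
    senv u (senv (fun z => G p z.1 z.2) m) \o f.
  by apply: funext => -[x|[[q x]|d]].
rewrite fE -sat_fmap => H; apply: stP; apply: filterS H => t.
by rewrite fE -(sat_fmap f).
Qed.
End Morley.

(** Both [a] and [b] realise the coheir over [M], so each of them followed by the common tail is
    indiscernible, and [c 2] is a midpoint. *)
Lemma same_type_ldist2 (a b : B -> C) :
  (forall phi : formula L (B + {x | M x}),
     sat (senv a m) phi -> sat (senv b m) phi) ->
  ldist_le 2 a b.
Proof.
move=> ab; have [U [Uu Ua]] := coheir_ultrafilter a.
have [c [c0 c1 cP]] := morley_sequence Uu a b.
have realizes (x : B -> C) n (e : 'I_n -> B -> C) : (n = 0) ->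
    (forall phi : formula L (B + {x | M x}),
     sat (senv a m) phi -> sat (senv x m) phi) -> realizes_over U e x.
  move=> n0 ax; subst n => phi.
  pose f (z : B + ('I_0 * B + {x | M x})) : B + {x | M x} :=
    match z with inl y => inl y | inr (inr d) => inr d
    | inr (inl (q, _)) => match notF (ltn_ord q) with end end.
  have fE u : senv u (senv (fun z => e z.1 z.2) m) = senv u m \o f.
    by apply: funext => -[y|[[[]]|d]].
  rewrite fE -sat_fmap => H; apply: ax.
  have [//|nsat] := pselect (sat (senv a m) (fmap f phi)).
  have [t [Ht]] := filter_ex (filterI H (Ua (fNeg (fmap f phi)) nsat)).
  by rewrite /= sat_fmap -fE.
have ind k : k < 2 -> indiscernible (fun p => if p is q.+1 then c q.+2 else c k).
  move=> k2; apply: (morley_indiscernible Uu) => -[|p] n i ip.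
    apply: realizes; first by case: n i ip => // n i /(_ ord0).
    case: k k2 => [|[|//]] _; by rewrite ?c0 ?c1.
  have -> : (fun p => if p is q.+1 then c q.+2 else c k) \o i =
      c \o (fun q => if i q is r.+1 then r.+2 else k).
    by apply: funext => q /=; case: (i q).
  apply: cP => q; case: (i q) (ip q) => // _.
  by apply: leq_trans k2 _.
(* Edges join distinct tuples only, so coincidences with the midpoint are treated apart. *)
have [ac|ac] := pselect (a = c 2); have [cb|cb] := pselect (c 2 = b).
- by exists a; split; [exists a; split=> //; left|left; rewrite ac].
- exists (c 2); split; first by exists a; split=> //; left.
  right; split=> //; exists (fun p => if p is q.+1 then c q.+2 else c 1).
  by split; [exact: ind|exists 1, 0].
- exists (c 2); split; last by left.
  exists a; split=> //; right; split=> //.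
  exists (fun p => if p is q.+1 then c q.+2 else c 0).
  by split; [exact: ind|exists 0, 1].
- exists (c 2); split.
    exists a; split=> //; right; split=> //.
    exists (fun p => if p is q.+1 then c q.+2 else c 0).
    by split; [exact: ind|exists 0, 1].
  right; split=> //; exists (fun p => if p is q.+1 then c q.+2 else c 1).
  by split; [exact: ind|exists 1, 0].
Qed.
End Coheirs.

(** * The number of generators bounds Lascar distance *)

Section LascarDistance.
Variables (L : language) (C : structure L) (B : Type).
Implicit Types a b c : B -> C.

Lemma ldist_le_trans n k a b c :
  ldist_le n a b -> ldist_le k b c -> ldist_le (k + n) a c.
Proof.
move=> ab; elim: k c => [c <- //|k IH c [d [/IH H dc]]].
by exists d.
Qed.

Lemma ldist_le_automorphism (s : C -> C) n a b : automorphism s ->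
  ldist_le n a b -> ldist_le n (s \o a) (s \o b).
Proof.
move=> sa; elim: n b => [b -> //|n IH b [c [/IH H cb]]].
exists (s \o c); split=> //; case: cb => [->|[ncb [e [ind [i [j [ei ej]]]]]]].
  by left.
right; split.
  move=> scb; apply: ncb; apply: funext => x.
  have [s' [_ ss' _]] := automorphism_inv sa.
  by apply: (can_inj ss'); exact: (congr1 (fun u => u x) scb).
exists (fun k => s \o e k); split; last by exists i, j; rewrite ei ej.
move=> k phi p q pinc qinc.
by rewrite !(sat_automorphism (fun z => e (_ z.1) z.2) _ sa); exact: ind.
Qed.

End LascarDistance.

(** A generator costs two steps: it fixes [t]([M]) pointwise, so after applying the inverse of [t] a
    tuple and its image have the same type over [M]. *)
Lemma strong_ldist (L : language) (K : Type) (C : structure L) (M : C -> Prop)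
    (B : Type) n (s : C -> C) (a : B -> C) :
  lt_card (nat -> bool) K -> saturated K C -> countable_model M ->
  countable_type B -> strong M n s -> ldist_le (n.*2) a (s \o a).
Proof.
move=> HK Hsat [Mc Mel] [h hi].
elim: n s => [s -> //|n IH s [s1 [s2 [/IH H1 [s2a [t ta tP]] ->]]]].
apply: (@ldist_le_trans _ _ _ _ 2 _ _ _ H1).
have [t' [t'a tt' t't]] := automorphism_inv ta.
have E u : u = t \o (t' \o u) :> (B -> C) by apply: funext => x /=; rewrite t't.
suff H : ldist_le 2 (t' \o (s1 \o a)) (t' \o (s2 \o (s1 \o a))).
  by have := ldist_le_automorphism ta H; rewrite -!E.
apply: (same_type_ldist2 HK Hsat Mc Mel hi) => phi.
have ra : automorphism (t' \o (s2 \o t)).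
  by apply: automorphism_comp => //; apply: automorphism_comp.
rewrite -(sat_automorphism _ _ ra); congr (sat _ phi).
apply: funext => -[x|[x Mx]] /=; first by rewrite t't.
by rewrite tP.
Qed.

(** * Baire category *)

Section Category.
Variables (I C : Type) (h : I -> nat).
Implicit Types (x y z : I -> C) (A D U : (I -> C) -> Prop).

(** Describes the cylinders of the product topology on a power of the discrete set [C]. Open, dense
    and comeager are relative to [Z] below. *)
Definition agree N x y := forall i, h i < N -> x i = y i.

Lemma agree_sym N x y : agree N x y -> agree N y x.
Proof. by move=> xy i /xy. Qed.

Lemma agree_trans N x y z : agree N x y -> agree N y z -> agree N x z.
Proof. by move=> xy yz i hN; rewrite xy // yz. Qed.

Lemma agree_leq N N' x y : N <= N' -> agree N' x y -> agree N x y.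
Proof. by move=> NN' xy i hN; apply: xy; apply: leq_trans NN'. Qed.

Lemma agree_comp (s : C -> C) N x y : agree N x y -> agree N (s \o x) (s \o y).
Proof. by move=> xy i hN /=; rewrite xy. Qed.

Variable Z : (I -> C) -> Prop.

Definition open_in U :=
  forall x, Z x -> U x -> exists N, forall y, Z y -> agree N x y -> U y.
Definition dense_in U :=
  forall x N, Z x -> exists y, [/\ Z y, agree N x y & U y].
Definition comeager A := exists2 D : nat -> (I -> C) -> Prop,
  forall n, open_in (D n) /\ dense_in (D n) &
  forall x, Z x -> (forall n, D n x) -> A x.

Definition baire_property A :=
  exists2 U, open_in U & comeager (fun z => A z <-> U z).

Lemma comeager_mono A A' : (forall z, Z z -> A z -> A' z) ->
  comeager A -> comeager A'.
Proof. by move=> AA' [D Dod DA]; exists D => // x Zx Dx; apply/AA'/DA. Qed.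

Lemma comeager_open_dense U : open_in U -> dense_in U -> comeager U.
Proof. by move=> oU dU; exists (fun=> U) => // x _ /(_ 0). Qed.

Lemma comeager_bigcap (A : nat -> (I -> C) -> Prop) :
  (forall n, comeager (A n)) -> comeager (fun z => forall n, A n z).
Proof.
move=> cA.
have /choice[D DP] n : exists D : nat -> (I -> C) -> Prop,
    (forall k, open_in (D k) /\ dense_in (D k)) /\
    forall x, Z x -> (forall k, D k x) -> A n x.
  by have [D] := cA n; exists D.
exists (fun j => if unpickle j is Some (n, k) then D n k else fun=> True).
  move=> j; case: (unpickle j) => [[n k]|]; first by have [+ _] := DP n; apply.
  by split=> [x _ _|x N Zx]; [exists 0|exists x].
move=> x Zx Dx n; have [_ +] := DP n; apply=> // k.
by have := Dx (pickle (n, k)); rewrite pickleK.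
Qed.

Lemma comeager_and A A' : comeager A -> comeager A' ->
  comeager (fun z => A z /\ A' z).
Proof.
move=> cA cA'; apply: (@comeager_mono (fun z => forall n, (if n is 0 then A else A') z)).
  by move=> z _ H; split; [exact: (H 0)|exact: (H 1)].
by apply: comeager_bigcap => -[|n].
Qed.

Lemma comeager_comp (s t : C -> C) A : cancel s t -> cancel t s ->
  (forall z, Z z -> Z (s \o z)) -> (forall z, Z z -> Z (t \o z)) ->
  comeager A -> comeager (fun z => A (t \o z)).
Proof.
move=> st ts Zs Zt [D Dod DA].
exists (fun n z => D n (t \o z)); last by move=> x Zx Dx; apply: DA => //; exact: Zt.
move=> n; have [oD dD] := Dod n; split.
- move=> x Zx Dx; have [N H] := oD _ (Zt _ Zx) Dx.
  by exists N => y Zy xy; apply: H; [exact: Zt|exact: agree_comp].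
- move=> x N Zx; have [y [Zy xy Dy]] := dD _ N (Zt _ Zx).
  exists (s \o y); split; first exact: Zs.
    by move=> i hN /=; rewrite -xy //= ts.
  suff -> : t \o (s \o y) = y by [].
  by apply: funext => i /=; rewrite st.
Qed.

Lemma baire_property_ext A A' : (forall z, Z z -> A z <-> A' z) ->
  baire_property A -> baire_property A'.
Proof.
move=> AA' [U oU cU]; exists U => //; apply: comeager_mono cU => z Zz <-.
by split=> /(AA' z Zz).
Qed.

Lemma baire_property_open U : open_in U -> baire_property U.
Proof.
move=> oU; exists U => //; exists (fun _ _ => True) => // _.
by split=> [x _ _|x N Zx]; [exists 0|exists x].
Qed.

(** The complement is approximated by the interior [V] of the complement of [U], as the union of [U]
    and [V] is open and dense. *)
Lemma baire_property_not A : baire_property A -> baire_property (fun z => ~ A z).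
Proof.
move=> [U oU cU].
pose V x := exists N, forall y, Z y -> agree N x y -> ~ U y.
have oV : open_in V.
  move=> x Zx [N H]; exists N => y Zy xy; exists N => z Zz yz.
  by apply: H => //; apply: agree_trans yz.
exists V => //.
have cUV : comeager (fun z => U z \/ V z).
  apply: comeager_open_dense.
    move=> x Zx [/(oU x Zx)|/(oV x Zx)] [N H]; exists N => y Zy xy.
      by left; apply: H.
    by right; apply: H.
  move=> x N Zx; have [[y [Zy xy Uy]]|no] :=
    pselect (exists y, [/\ Z y, agree N x y & U y]).
    by exists y; split=> //; left.
  exists x; split=> //; right; exists N => y Zy xy Uy; apply: no.
  by exists y.
apply: comeager_mono (comeager_and cU cUV) => z Zz [AU [Uz|Vz]].
  split=> [nA|[N H]]; first by case: nA; apply/AU.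
  by case: (H z Zz).
split=> // _ /AU Uz; have [N H] := Vz; exact: (H z).
Qed.

Lemma baire_property_bigcup (A : nat -> (I -> C) -> Prop) :
  (forall n, baire_property (A n)) ->
  baire_property (fun z => exists n, A n z).
Proof.
move=> bA.
have /choice[U UP] n : exists U, open_in U /\ comeager (fun z => A n z <-> U z).
  by have [U] := bA n; exists U.
exists (fun z => exists n, U n z).
  move=> x Zx [n Ux]; have [+ _] := UP n; move=> /(_ x Zx Ux)[N H]; exists N => y Zy xy.
  by exists n; apply: H.
apply: comeager_mono (comeager_bigcap (fun n => proj2 (UP n))) => z Zz AU.
by split=> -[n /AU]; exists n.
Qed.

Variables (G : nat -> (I -> C) -> Prop) (X : (I -> C) -> Prop).
Hypothesis Gopen : forall n x, G n x ->
  exists N, forall y, agree N x y -> G n y.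
Hypothesis Xclosed : forall x, (forall N, exists2 y, X y & agree N y x) -> X x.
Hypothesis ZE : forall x, Z x <-> X x /\ forall n, G n x.

(** Nested cylinders are chosen inside the successive [D n] and [G n]. The limit lies in [Z] because
    [X] is closed and the cylinders lie in [G n] outright, not merely relative to [Z]. *)
Theorem baire_category A x N : comeager A -> Z x ->
  exists y, [/\ Z y, agree N x y & A y].
Proof.
move=> [D Dod DA] Zx.
have /choice[st stP] (u : nat * ((I -> C) * nat)) : exists v : (I -> C) * nat,
    Z u.2.1 -> [/\ Z v.1, agree u.2.2 u.2.1 v.1, u.1 < v.2, u.2.2 <= v.2 &
      (forall y, agree v.2 v.1 y -> G u.1 y) /\
      (forall y, Z y -> agree v.2 v.1 y -> D u.1 y)].
  case: u => n [z k] /=; have [Zz|nZ] := pselect (Z z); last by exists (z, k).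
  have [oD dD] := Dod n; have [y [Zy zy Dy]] := dD z k Zz.
  have [N1 H1] := oD y Zy Dy.
  have [_ /(_ n)Gy] := iffLR (ZE y) Zy; have [N2 H2] := Gopen Gy.
  exists (y, maxn (maxn n.+1 k) (maxn N1 N2)) => _ /=.
  split=> //; rewrite ?leq_max ?leqnn ?orbT //.
  split=> [w yw|w Zw yw]; [apply: H2|apply: H1] => //;
    by apply: agree_leq yw; rewrite !leq_max leqnn ?orbT.
pose s := fix s n := if n is n'.+1 then st (n', s n') else (x, N).
have sZ n : Z (s n).1.
  by elim: n => // n /(stP (n, s n))[].
have sS n := stP (n, s n) (sZ n).
have sN n : n <= (s n).2 by case: n => // n; have [] := sS n.
have mono k n : n <= k -> agree (s n).2 (s n).1 (s k).1 /\ (s n).2 <= (s k).2.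
  move=> /subnK <-; elim: (k - n) => // j [IH1 IH2].
  have [_ H1 _ H2 _] := sS (j + n); split; last exact: leq_trans H2.
  by apply: agree_trans IH1 _; apply: agree_leq H1.
(* Stage [n] fixes all codes below [n], so coordinate [i] is settled at stage [(h i).+1]. *)
pose y i := (s (h i).+1).1 i.
have sy n : agree (s n).2 (s n).1 y.
  move=> i hn; have [+ _] := mono (maxn n (h i).+1) n (leq_maxl _ _).
  move=> ->//; have [+ _] := mono (maxn n (h i).+1) (h i).+1 (leq_maxr _ _).
  by move=> <-//; apply: leq_trans (sN _).
have Zy : Z y.
  apply/ZE; split.
    apply: Xclosed => k; exists (s k).1; first by have [] := iffLR (ZE _) (sZ k).
    exact: agree_leq (sy k).
  by move=> n; have [_ _ _ _ [+ _]] := sS n; apply; exact: (sy n.+1).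
exists y; split=> //; first exact: (sy 0).
by apply: DA => // n; have [_ _ _ _ [_ +]] := sS n; apply => //; exact: (sy n.+1).
Qed.

(** Abstracts being joined by an [n]-step strong automorphism. The hypothesis is topological
    transitivity: homeomorphisms of [Z] that move points along some [R n] take any point into any
    cylinder. *)
Variable R : nat -> (I -> C) -> (I -> C) -> Prop.
Hypothesis Rtrans : forall x y N, Z x -> Z y -> exists s t : C -> C,
  [/\ cancel s t, cancel t s,
      forall z, Z z -> [/\ Z (s \o z), Z (t \o z) & exists n, R n z (s \o z)] &
      agree N (s \o x) y].

(** If [U] is neither dense nor empty in [Z], a cylinder inside [U] can be moved onto one that
    misses [U], against invariance. *)
Lemma zero_one_law A : baire_property A ->
  (forall n x y, Z x -> Z y -> R n x y -> A x -> A y) ->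
  comeager A \/ comeager (fun z => ~ A z).
Proof.
move=> [U oU cU] Ainv.
have [dU|ndU] := pselect (dense_in U).
  left; apply: comeager_mono (comeager_and cU (comeager_open_dense oU dU)).
  by move=> z _ [AU /AU].
have [[x [Zx Ux]]|no] := pselect (exists x, Z x /\ U x); last first.
  right; apply: comeager_mono cU => z Zz AU /AU Uz.
  by apply: no; exists z.
have [y [N [Zy HN]]] : exists y N, Z y /\ forall z, Z z -> agree N y z -> ~ U z.
  apply: contrapT => no; apply: ndU => y N Zy; apply: contrapT => no'.
  apply: no; exists y, N; split=> // z Zz yz Uz.
  by apply: no'; exists z.
have [N' HN'] := oU x Zx Ux.
have [s [t [st ts stZ sxy]]] := Rtrans (maxn N N') Zx Zy.
have cUt : comeager (fun z => A (t \o z) <-> U (t \o z)).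
  by apply: (comeager_comp (A := fun z => A z <-> U z) st ts) cU => z /stZ[].
have [Zsx _ _] := stZ x Zx.
(* For this generic [w] near [s \o x], the point [t \o w] is near [x], hence in [U] and in [A];
   invariance puts [w] in [A], yet [w] is near [y] and so off [U]. *)
have [w [Zw sxw [AUw AUtw]]] :=
  baire_category (maxn N N') (comeager_and cU cUt) Zsx.
have [_ Ztw _] := stZ w Zw.
have [_ _ [n]] := stZ _ Ztw.
have -> : s \o (t \o w) = w by apply: funext => i /=; rewrite ts.
move=> Rn; have Aw : A w.
  apply: Ainv Rn _ => //; apply/AUtw; apply: HN' => // i hi'.
  by rewrite /= -sxw /= ?st // leq_max hi' orbT.
case: (HN w) => //; last exact/AUw.
apply: agree_leq (leq_maxl N N') _.
exact: agree_trans (agree_sym sxy) sxw.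
Qed.

(* By the zero-one law [f] is constant on a comeager set, so that one class is
   comeager; it is a countable union of closed sets, one of which therefore has
   interior. *)
Lemma cylinder_of_invariant (f : (I -> C) -> nat -> bool) :
  (exists x, Z x) ->
  (forall n, baire_property (fun z => f z n)) ->
  (forall n x y, Z x -> Z y -> R n x y -> f x = f y) ->
  (forall x y, Z x -> Z y -> f x = f y -> exists n, R n x y) ->
  (forall n b, open_in (fun z => ~ R n b z)) ->
  exists n b x N, [/\ Z b, Z x & forall y, Z y -> agree N x y -> R n b y].
Proof.
move=> [x0 Zx0] fB finv fR Ropen.
have /choice[v vP] n : exists v, comeager (fun z => f z n = v).
  have [|H|H] := zero_one_law (fB n).
  - by move=> k x y Zx Zy /(finv k x y Zx Zy) ->.
  - by exists true.
  - by exists false; apply: comeager_mono H => z _; case: (f z n).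
have cf := comeager_bigcap vP.
have [b [Zb _ fb]] := baire_category 0 cf Zx0.
apply: contrapT => no.
have cR : comeager (fun z => forall n, ~ R n b z).
  apply: comeager_bigcap => n; apply: comeager_open_dense => //.
  move=> x N Zx; apply: contrapT => no'; apply: no; exists n, b, x, N.
  split=> // y Zy xy; apply: contrapT => nR; apply: no'.
  by exists y.
have [z [Zz _ [fz nR]]] := baire_category 0 (comeager_and cf cR) Zx0.
have [|n Rn] := fR b z Zb Zz; last exact: nR Rn.
by apply: funext => n; rewrite fb fz.
Qed.

End Category.

(** * Finite subtuples, pseudo open sets and Borel sets of types *)

(** Boundedness is assumed for increasing subtuples only, so a finite set of coordinates is sorted
    and freed of repetitions. *)
Lemma finite_increasing (I : Type) (ltI : I -> I -> Prop) n (g : 'I_n -> I) :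
  ordinal_like ltI ->
  exists k (s : 'I_k -> I), (forall p q : 'I_k, p < q -> ltI (s p) (s q)) /\
    forall i, exists q, s q = g i.
Proof.
move=> [_ [lt_trans lt_total]].
have [[x0 _]|no] := pselect (exists x : I, True); last first.
  by exists n, g; split=> [p|i]; case: no; [exists (g p)|exists (g i)].
pose T := {classic I}.
pose le (x y : T) := `[< x = y \/ ltI x y >].
have le_total : total le.
  move=> x y; apply/orP; case: (lt_total x y) => [xy|[->|yx]].
  - by left; apply/asboolP; right.
  - by left; apply/asboolP; left.
  - by right; apply/asboolP; right.
have le_trans : transitive le.
  move=> y x z /asboolP[->//|xy] /asboolP[<-|yz]; apply/asboolP; first by right.
  by right; apply: lt_trans yz.
pose l : seq T := sort le (undup [seq (g i : T) | i <- enum 'I_n]).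
have l_sorted : sorted le l by apply: sort_sorted.
have l_uniq : uniq l by rewrite sort_uniq undup_uniq.
exists (size l), (fun q => nth (x0 : T) l q); split=> [p q pq|i].
  have /asboolP[pq'|//] : le (nth (x0 : T) l p) (nth (x0 : T) l q).
    by apply: (sorted_ltn_nth le_trans) => //; rewrite inE.
  have := nth_uniq (x0 : T) (ltn_ord p) (ltn_ord q) l_uniq.
  by rewrite pq' eqxx => /esym/eqP pq''; rewrite pq'' ltnn in pq.
have gl : (g i : T) \in l.
  by rewrite mem_sort mem_undup; apply: map_f; rewrite mem_enum.
have il : index (g i : T) l < size l by rewrite index_mem.
by exists (Ordinal il); rewrite /= nth_index.
Qed.

Lemma pform_support (L : language) (C : structure L) (A : C -> Prop) (I : Type)
    (h : I -> nat) (phi : pform I A) :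
  exists N, forall x y : I -> C, agree h N x y -> psat x phi = psat y phi.
Proof.
have [N NP] := sat_support (senv h (fun=> 0)) (pphi phi).
by exists N => x y xy; apply: NP => -[i /xy|].
Qed.

(** A point outside a type-definable set violates one formula, which sees finitely many
    coordinates. *)
Lemma pseudo_open_agree (L : language) (K : Type) (C : structure L) (I : Type)
    (h : I -> nat) (U : (I -> C) -> Prop) x :
  pseudo_open K U -> U x -> exists N, forall y, agree h N x y -> U y.
Proof.
move=> [A [_ [S SP]]] Ux.
have [phi [Sphi nphi]] : exists phi, S phi /\ ~ psat x phi.
  apply: contrapT => no; apply: (iffRL (SP x)) Ux => phi Sphi.
  by apply: contrapT => nphi; apply: no; exists phi.
have [N NP] := pform_support h phi; exists N => y xy.
by apply: contrapT => /SP/(_ phi Sphi); rewrite -(NP x y xy).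
Qed.

Section TypeSpace.
Variables (L : language) (C : structure L) (M : C -> Prop) (I : Type).
Variables (h : I -> nat) (Y Z : (I -> C) -> Prop).
Hypothesis ZY : forall z, Z z -> Y z.
Local Notation Om := (@typeset L C M I Y).

(** Taking types over [M] is continuous, and the sets with the Baire property form a
    sigma-algebra. *)
Lemma borel_baire_property (A : (pform I M -> Prop) -> Prop) :
  sigma_gen Om (stone_open Om) A ->
  baire_property h Z (fun z => A (tp (M := M) z)).
Proof.
move=> /(_ (fun A => baire_property h Z (fun z => A (tp z)))); apply.
- move=> U [_ UP]; apply: baire_property_open => x Zx /UP[phi [xphi phiP]].
  have [N NP] := pform_support h phi; exists N => y Zy xy.
  apply: phiP; last by rewrite /tp -(NP x y xy).
  by exists y; split=> //; apply: ZY.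
- move=> U /baire_property_not; apply: baire_property_ext => z Zz.
  split=> [nU|[]//]; split=> //; exists z; split=> //; exact: ZY.
- by move=> F; apply: baire_property_bigcup.
Qed.
End TypeSpace.

Lemma tp_eq_sat (L : language) (C : structure L) (M : C -> Prop) (B : Type)
    (a b : B -> C) (phi : formula L (B + {x | M x})) :
  countable_model M -> tp (M := M) a = tp b ->
  sat (senv a sval) phi -> sat (senv b sval) phi.
Proof.
move=> [Mc [m0 _]] ab.
have [p pP] := pform_of_formula m0 phi Mc (fun y => proj2_sig y).
by rewrite -!pP -[psat a p]/(tp a p) ab.
Qed.

(** * A Borel reduction bounds every class *)

Theorem theorem3p6
  (L : language) (HL : countable_language L)
  (T : sentence L -> Prop) (HT : complete_theory T)
  (K : Type) (C : structure L) (HC : monster K C T)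
  (I : Type) (ltI : I -> I -> Prop) (HI : ordinal_like ltI)
  (HIc : countable_type I) (HIinf : injects nat I)
  (Y : (I -> C) -> Prop) (HY : pseudo_Gdelta K Y)
  (HYcl : forall a b, Y a -> lascar_eq a b -> Y b)
  (Hfin : forall a, Y a -> forall k (s : 'I_k -> I),
      (forall p q : 'I_k, (p < q)%N -> ltI (s p) (s q)) ->
      d_bounded (lclass (a \o s))) :
  (exists a, Y a /\ ~ d_bounded (lclass a)) ->
  forall M : C -> Prop, countable_model M ->
    ~ smooth (@typeset L C M I Y) (stone_open (@typeset L C M I Y))
        (@ltypeE L C M I).
Proof.
move=> [a [Ya nda]] M CM [f [fborel fE]]; apply: nda.
have [_ [Hsat [Hhom HK]]] := HC; have [Mc Mel] := CM.
have [h hi] := HIc; have [i0 _] : exists i0 : I, True.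
  by have [g _] := HIinf; exists (g 0).
have ldist_strong B n (u v : B -> C) : countable_type B -> ldist_le n u v ->
    exists2 s, strong M n s & s \o u = v.
  by move=> Bc; exact: (ldist_le_strong HK Hsat Hhom Mc).
have strong_ld B n (s : C -> C) (u : B -> C) : countable_type B ->
    strong M n s -> ldist_le n.*2 u (s \o u).
  by move=> Bc; exact: (strong_ldist _ HK Hsat CM).
(* [X] is the closure of the orbit of [a] under strong automorphisms. *)
pose X x := forall N, exists n s, strong M n s /\ agree h N (s \o a) x.
pose Z x := Y x /\ X x.
have Xs n s x : strong M n s -> X x -> X (s \o x).
  move=> ss Xx N; have [k [t [tt tx]]] := Xx N.
  exists (n + k), (s \o t); split; first exact: strong_comp.
  exact: agree_comp tx.
have Zs n s x : strong M n s -> Z x -> Z (s \o x).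
  move=> ss [Yx Xx]; split; last exact: Xs ss Xx.
  by apply: HYcl Yx _; exists n.*2; exact: (strong_ld _ _ _ x HIc ss).
have Za : Z a by split=> // N; exists 0, (@id C); split.
have Xtrans N x y : X x -> X y -> exists n s, strong M n s /\ agree h N (s \o x) y.
  move=> Xx Xy; have [k [s [ss sx]]] := Xx N; have [l [t [tt ty]]] := Xy N.
  have [s' [ss' sK _]] := strong_inv ss.
  exists (l + k), (t \o s'); split; first exact: strong_comp.
  by move=> i hiN /=; rewrite -sx //= sK; exact: ty.
have Xbounded N : exists n, forall x y, X x -> X y ->
    exists s, strong M n s /\ agree h N (s \o x) y.
  have [g [r gr]] := finite_retract i0 N hi.
  have [k [s [sinc sg]]] := finite_increasing g HI.
  have [n Hn] := Hfin a Ya k s sinc.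
  (* The entries of [s] may have codes beyond [N], because [g] takes default values; agreement below
     [N'] controls all of them. *)
  pose N' := \max_q (h (s q)).+1.
  have restrict (x y : I -> C) : agree h N' x y -> x \o s = y \o s.
    move=> xy; apply: funext => q; apply: xy.
    exact: (leq_bigmax (F := fun q => (h (s q)).+1)).
  have Xlascar x y : X x -> X y -> lascar_eq (x \o s) (y \o s).
    move=> Xx Xy; have [l [t [tt txy]]] := Xtrans N' x y Xx Xy.
    exists l.*2; rewrite -(restrict _ _ txy).
    exact: (strong_ld _ _ _ (x \o s) (countable_type_ord k) tt).
  have Xa : X a by have [] := Za.
  exists n => x y Xx Xy.
  have /Hn := Xlascar _ _ Xx Xy.
  move=> /(_ (Xlascar _ _ Xa Xx) (Xlascar _ _ Xa Xy)) xyn.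
  have [t tt txy] := ldist_strong _ _ _ _ (countable_type_ord k) xyn.
  exists t; split=> // i hiN; have [q sq] := sg (r i).
  by rewrite -(gr i hiN) -sq; exact: (congr1 (fun u => u q) txy).
have [U [Uopen YU]] := HY.
pose R n (x y : I -> C) := exists2 s, strong M n s & s \o x = y.
have Rlascar n x y : R n x y -> lascar_eq x y.
  by move=> [s ss <-]; exists n.*2; exact: (strong_ld _ _ _ x HIc ss).
have typesetZ x : Z x -> typeset Y (tp (M := M) x).
  by move=> [Yx _]; exists x.
have [n [b [x0 [N0 [Zb Zx0 Rcyl]]]]] : exists n b x N,
    [/\ Z b, Z x & forall y, Z y -> agree h N x y -> R n b y].
  apply: (@cylinder_of_invariant I C h Z U X _ _ _ R _ (fun z => f (tp z))).
  - by move=> k x; exact: pseudo_open_agree.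
  - move=> x Xx N; have [y Xy yx] := Xx N; have [k [s [ss sy]]] := Xy N.
    by exists k, s; split=> //; exact: agree_trans yx.
  - by move=> x; split=> [[/YU Ux Xx]|[Xx /YU Yx]].
  - move=> x y N Zx Zy; have [k [s [ss sxy]]] := Xtrans N x y Zx.2 Zy.2.
    have [t [tt st ts]] := strong_inv ss.
    exists s, t; split=> // z Zz; split; [exact: Zs ss Zz|exact: Zs tt Zz|].
    by exists k, s.
  - by exists a.
  - move=> k.
    have ZY z : Z z -> Y z by case.
    have := fborel (fun u => u k); set A := (fun p => _ /\ _) => H.
    have {}H : baire_property h Z (fun z => A (tp (M := M) z)).
      apply: (@borel_baire_property _ _ _ _ _ Y _ ZY A); apply: H => S SG _ _.
      by apply: SG => u uk; exists k.+1 => v uv; rewrite uv.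
    apply: baire_property_ext H => z Zz; rewrite /A.
    by split=> [[]//|]; split=> //; exact: typesetZ.
  - move=> k x y Zx Zy Rxy; apply/fE; [exact: typesetZ..|].
    by exists x, y; split=> //; split=> //; exact: Rlascar Rxy.
  (* Equal images give Lascar equivalent [u] and [v] with the types of [x] and [y]; passing from [x]
     to [u] and from [v] to [y] costs two steps each. *)
  - move=> x y Zx Zy /fE[||u [v [ux [vy [k uv]]]]]; [exact: typesetZ..|].
    have xu : ldist_le 2 x u.
      by apply: (same_type_ldist2 HK Hsat Mc Mel hi) => phi; apply: tp_eq_sat.
    have vy2 : ldist_le 2 v y.
      by apply: (same_type_ldist2 HK Hsat Mc Mel hi) => phi; apply: tp_eq_sat.
    exists (2 + (k + 2)); apply: ldist_strong => //.
    exact: ldist_le_trans (ldist_le_trans xu uv) vy2.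
  (* By finite character, not being reached in [k] steps is witnessed on a cylinder. *)
  - move=> k x y Zy nR.
    have [N HN] : exists N, ~ exists2 s, strong M k s & agree h N (s \o x) y.
      apply: contrapT => no; apply: nR.
      apply: (strong_finite_character HK Hsat Hhom Mc hi) => N.
      by apply: contrapT => no'; apply: no; exists N.
    exists N => z Zz yz [s ss sz]; apply: HN; exists s => //.
    by rewrite sz; exact: agree_sym.
have [m Hm] := Xbounded N0.
(* The image of [b] enters the cylinder in [m] steps, [n] steps from [b] reach that point, and the
   [m] steps are undone. *)
have Rb k s : strong M k s -> R (m + n) b (s \o b).
  move=> ss; have Zsb := Zs _ _ _ ss Zb.
  have [t [tt tx0]] := Hm _ _ Zsb.2 Zx0.2.
  have [s' ss' s'E] := Rcyl _ (Zs _ _ _ tt Zsb) (agree_sym tx0).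
  have [t' [tt' tK _]] := strong_inv tt.
  exists (t' \o s'); first exact: strong_comp.
  rewrite -[LHS]/(t' \o (s' \o b)) s'E.
  by apply: funext => i /=; rewrite tK.
(* A priori [a] is only a limit of images of [b]; the uniform bound [m + n] passes to the limit. *)
have [s ss sba] : R (m + n) b a.
  apply: (strong_finite_character HK Hsat Hhom Mc hi) => N.
  have [k [t [tt tba]]] := Xtrans N b a Zb.2 Za.2.
  have [s ss sE] := Rb k t tt; exists s => // i hiN.
  by rewrite -tba // -sE.
have Ra u : lclass a u -> R (m + n) b u.
  move=> [k /(ldist_strong _ _ _ _ HIc)[t tt <-]]; rewrite -sba.
  by apply: (Rb (k + (m + n)) (t \o s)); exact: strong_comp.
(* The path goes from [u] back to [b] and on to [v]; doubling converts generators into Lascar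
   steps. *)
exists ((m + n) + (m + n)).*2 => u v /Ra[su ssu <-] /Ra[sv ssv <-].
split=> [_|H]; last by exists ((m + n) + (m + n)).*2.
have [t [tt tK _]] := strong_inv ssu.
have := strong_ld _ _ _ (su \o b) HIc (strong_comp tt ssv).
congr ldist_le; apply: funext => i /=; by rewrite tK.
Qed.
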